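(* Let $I$ be a finite set of indices. For each $i\in I$ let $G_i$ be a finitely generated acylindrically hyperbolic group and let $G=\prod_{i\in I}G_i$ denote their product, with canonical projections $\psi_i\colon G\to G_i$. Let $H$ be a subgroup of $G$. Suppose that $\psi_i(H)\le G_i$ contains a generalized loxodromic element of $G_i$ for every $i\in I$. Then $H$ has a relative ambiguity function in $G$ that is bounded above by a polynomial of degree $|I|$. Further, the relative growth rate of $H$ exists with respect to every finite generating set of $G$; that is, $\lim_{n\to\infty}\sqrt[n]{\beta_H^X(n)}$ exists for every finite generating set $X$ of $G$.
   Context: $\mathbb{N}$ contains $0$. For a group $G$ with finite generating set $X$, $|g|_X$ denotes word length with respect to $X\cup X^{-1}$; for a subgroup $H\le G$ (not necessarily finitely generated) and $n\in\mathbb{N}$, $B_H^X(n)=\{h\in H:|h|_X\le n\}$ and $\beta_H^X(n)=|B_H^X(n)|$. Let $G$ be a group with finite generating set $X$ and $H\le G$ a subgroup. A function $\Phi\colon H\times H\to H$ is a concatenation map of $H$ in $G$ if there is a constant $\varepsilon\in\mathbb{N}$ such that for all $h,k\in H$ one has $\Phi(h,k)=h\,x_{h,k}\,k$ with $x_{h,k}\in B_H^X(\varepsilon)$. For $m,n\in\mathbb{N}$ let $\Phi_{m,n}$ be the restriction of $\Phi$ to $B_H^X(m)\times B_H^X(n)$. A function $f\colon\mathbb{N}\to\mathbb{N}$ is a relative ambiguity function for $\Phi$ (and of $H$ in $G$, with respect to $X$) if $|\Phi_{m,n}^{-1}(g)|\le f(n)$ for all $m,n\in\mathbb{N}$ and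 all $g\in H$. Up to precomposing $f$ with multiplication by a constant, this does not depend on $X$, so existence of a relative ambiguity function bounded above by a polynomial of given degree is independent of $X$. A hyperbolic space is a geodesic metric space that is Gromov hyperbolic. An action of a group $G$ by isometries on a metric space $(\Omega,d)$ is acylindrical if for every $\varepsilon>0$ there are constants $R,N>0$ such that for all $x,y\in\Omega$ with $d(x,y)\ge R$ there are at most $N$ elements $g\in G$ with $d(x,gx)\le\varepsilon$ and $d(y,gy)\le\varepsilon$. For an action on a hyperbolic space $\Omega$, an element $g$ is loxodromic if $\mathbb{Z}\to\Omega$, $n\mapsto g^n x$, is a quasigeodesic for some (equivalently any) $x$. An acylindrical action of $G$ on a hyperbolic space is elementary if $G$ has bounded orbits, or $G$ is virtually cyclic and contains a loxodromic element; otherwise it is non-elementary. $G$ is acylindrically hyperbolic if it admits a non-elementary acylindrical action on a hyperbolic space. An element $g\in G$ is generalized loxodromic if there is an acylindrical action of $G$ on a hyperbolic space for which $g$ is loxodromic. *)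

(* Defs.v *)
From HB Require Import structures.
From mathcomp Require Import all_boot all_order all_algebra finmap.
From mathcomp Require Import all_classical all_reals all_analysis.

Set Implicit Arguments.
Unset Strict Implicit.
Unset Printing Implicit Defensive.

Import Order.TTheory GRing.Theory Num.Theory.

Local Open Scope group_scope.
Local Open Scope classical_set_scope.
Local Open Scope card_scope.

(* Direct product of a finite family of groups.  MathComp puts a group
   structure only on the non-dependent {ffun I -> G}. *)
Definition gprod (I : finType) (G : I -> groupType) : Type :=
  {dffun forall i : I, G i}.

Section DirectProduct.
Context {I : finType} (G : I -> groupType).

HB.instance Definition _ := Choice.copy (gprod G) {dffun forall i : I, G i}.

Definition gprod_one : gprod G := [ffun i => 1].
Definition gprod_inv (g : gprod G) : gprod G := [ffun i => (g i)^-1].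
Definition gprod_mul (g h : gprod G) : gprod G := [ffun i => g i * h i].

Fact gprod_mulgA : associative gprod_mul.
Proof. by move=> x y z; apply/ffunP => i; rewrite !ffunE mulgA. Qed.
Fact gprod_mul1g : left_id gprod_one gprod_mul.
Proof. by move=> x; apply/ffunP => i; rewrite !ffunE mul1g. Qed.
Fact gprod_mulg1 : right_id gprod_one gprod_mul.
Proof. by move=> x; apply/ffunP => i; rewrite !ffunE mulg1. Qed.
Fact gprod_mulVg : left_inverse gprod_one gprod_inv gprod_mul.
Proof. by move=> x; apply/ffunP => i; rewrite !ffunE mulVg. Qed.
Fact gprod_mulgV : right_inverse gprod_one gprod_inv gprod_mul.
Proof. by move=> x; apply/ffunP => i; rewrite !ffunE mulgV. Qed.

HB.instance Definition _ := isGroup.Build (gprod G)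
  gprod_mulgA gprod_mul1g gprod_mulg1 gprod_mulVg gprod_mulgV.

Definition gproj (i : I) (g : gprod G) : G i := g i.

End DirectProduct.

Section WordLength.
Context {G : groupType}.
Implicit Types (X : {fset G}) (w : seq G) (H : groupClosed G).

Definition is_word X w : bool := all (fun x => (x \in X) || (x^-1 \in X)) w.

Definition spelled X (g : G) (n : nat) : Prop :=
  exists w, [/\ is_word X w, size w = n & \prod_(x <- w) x = g].

Definition generates X : Prop := forall g : G, exists n, spelled X g n.

(* Least length of a word spelling g.  The value 0 off the subgroup generated
   by X is never used: X is a generating set below. *)
Definition word_length X (g : G) : nat :=
  if pselect (exists n, `[< spelled X g n >]) is left ex then ex_minn ex else 0.

(* Subgroups are boolean predicates (groupClosed); no generality is lost, since
   every set is decidable in the presence of the axioms of boolp. *)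
Definition rel_ball X H (n : nat) : set G :=
  [set h | h \in H /\ (word_length X h <= n)%N].

(* fset_set is the cardinality-preserving map on finite sets; see
   finite_rel_ball below. *)
Definition rel_growth X H (n : nat) : nat := #|` fset_set (rel_ball X H n)|.

(* A map H x H -> H is given by a map on G x G of which only the values on
   H x H matter; these lie in H because x does. *)
Definition concatenation_map X H (Phi : G -> G -> G) : Prop :=
  exists eps : nat, forall h k, h \in H -> k \in H ->
    exists2 x, rel_ball X H eps x & Phi h k = h * x * k.

Definition ambiguity_function_for X H (Phi : G -> G -> G) (f : nat -> nat) :
    Prop :=
  forall (m n : nat) (g : G), g \in H ->
    [set hk : G * G | [/\ rel_ball X H m hk.1, rel_ball X H n hk.2
                        & Phi hk.1 hk.2 = g]] #<= `I_(f n).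

Definition relative_ambiguity_function X H (f : nat -> nat) : Prop :=
  exists2 Phi, concatenation_map X H Phi & ambiguity_function_for X H Phi f.

Lemma word_length_spelled X g : generates X -> spelled X g (word_length X g).
Proof.
move=> /(_ g)[n gn]; rewrite /word_length.
case: pselect => [ex|[]]; last by exists n; apply/asboolP.
by case: ex_minnP => m /asboolP.
Qed.

Lemma word_length_min X g n : spelled X g n -> (word_length X g <= n)%N.
Proof.
move=> gn; rewrite /word_length.
case: pselect => [ex|//]; case: ex_minnP => m _; apply; exact/asboolP.
Qed.

Lemma finite_rel_ball X H n : generates X -> finite_set (rel_ball X H n).
Proof.
move=> genX.
pose Y := enum_fset X ++ [seq x^-1 | x <- enum_fset X].
have words_fin m : finite_set [set w : seq G | is_word X w /\ size w = m].
  elim: m => [|m IH].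
    apply: (@sub_finite_set _ _ [set [::]]); last exact: finite_set1.
    by move=> w [_ /size0nil ->].
  apply: (@sub_finite_set _ _ ((fun p : G * seq G => p.1 :: p.2) @`
      ([set` Y] `*` [set w | is_word X w /\ size w = m]))).
    move=> [|x w] [] //= /andP[xX wX] [sw]; exists (x, w) => //; split=> //=.
    rewrite /mkset mem_cat; case/orP: xX => [->//|xX].
    by apply/orP; right; apply/mapP; exists x^-1; rewrite ?invgK.
  apply: finite_image; apply: finite_setX => //.
apply: (@sub_finite_set _ _ ((fun w : seq G => \prod_(x <- w) x) @`
    \bigcup_(m in `I_n.+1) [set w | is_word X w /\ size w = m])).
  move=> g [_ gn]; have [w [wX sw wg]] := word_length_spelled g genX.
  by exists w => //; exists (word_length X g).
by apply: finite_image; apply: bigcup_finite => //; exact: finite_II.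
Qed.

End WordLength.

Definition finitely_generated (G : groupType) : Prop :=
  exists X : {fset G}, generates X.

Definition expgz (G : groupType) (g : G) (m : int) : G :=
  match m with Posz n => g ^+ n | Negz n => g ^- n.+1 end.

(* Some cyclic subgroup <z> has finitely many cosets <z>t. *)
Definition virtually_cyclic (G : groupType) : Prop :=
  exists (z : G) (T : {fset G}),
    forall g, exists (m : int) (t : G), t \in T /\ g = expgz z m * t.

Local Open Scope ring_scope.

Section HyperbolicSpaces.
Context {R : realType} (Omega : metricType R).
Implicit Types x y z w : Omega.
Local Notation dist := (@mdist R Omega).

Definition geodesic_space : Prop :=
  forall x y, exists gamma : R -> Omega,
    [/\ gamma 0 = x, gamma (dist x y) = y &
      forall s t : R, 0 <= s <= dist x y -> 0 <= t <= dist x y ->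
        dist (gamma s) (gamma t) = `|s - t|].

Definition gromov_product w x y : R := (dist x w + dist y w - dist x y) / 2.

Definition gromov_hyperbolic : Prop :=
  exists delta : R, forall w x y z,
    Num.min (gromov_product w x y) (gromov_product w y z) - delta
      <= gromov_product w x z.

Definition hyperbolic_space : Prop := geodesic_space /\ gromov_hyperbolic.

Definition quasigeodesic (q : int -> Omega) : Prop :=
  exists lambda c : R, [/\ 1 <= lambda, 0 <= c &
    forall m n : int,
      lambda^-1 * `|m - n|%:~R - c <= dist (q m) (q n)
        <= lambda * `|m - n|%:~R + c].

End HyperbolicSpaces.

Section Actions.
Context {R : realType} {G : groupType} {Omega : metricType R}.
Variable act : G -> Omega -> Omega.

Definition isometric_action : Prop :=
  [/\ forall x, act 1%g x = x,
      forall g h x, act (g * h)%g x = act g (act h x) &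
      forall g x y, mdist (act g x) (act g y) = mdist x y].

Definition acylindrical : Prop :=
  forall eps : R, 0 < eps ->
    exists (rho : R) (N : nat), [/\ 0 < rho, (0 < N)%N &
      forall x y : Omega, rho <= mdist x y ->
        [set g | mdist x (act g x) <= eps /\ mdist y (act g y) <= eps]
          #<= `I_N].

Definition loxodromic (g : G) : Prop :=
  exists x : Omega, quasigeodesic (fun n : int => act (expgz g n) x).

Definition bounded_orbits : Prop :=
  forall x : Omega, exists C : R,
    forall g h : G, mdist (act g x) (act h x) <= C.

Definition elementary : Prop :=
  bounded_orbits \/ (virtually_cyclic G /\ exists g, loxodromic g).

Definition acylindrical_hyperbolic_action : Prop :=
  [/\ hyperbolic_space Omega, isometric_action & acylindrical].

End Actions.

Definition acylindrically_hyperbolic (R : realType) (G : groupType) : Prop :=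
  exists (Omega : metricType R) (act : G -> Omega -> Omega),
    acylindrical_hyperbolic_action act /\ ~ elementary act.

Definition generalized_loxodromic (R : realType) (G : groupType) (g : G) :
    Prop :=
  exists (Omega : metricType R) (act : G -> Omega -> Omega),
    acylindrical_hyperbolic_action act /\ loxodromic act g.

(* The n-th root of the relative growth function; the junk value at n = 0 does
   not affect convergence. *)
Definition rel_growth_root (R : realType) (G : groupType) (X : {fset G})
    (H : groupClosed G) (n : nat) : R :=
  (rel_growth X H n)%:R `^ n%:R^-1.

(* Main.v *)
Require Import Defs.
From HB Require Import structures.
From mathcomp Require Import all_boot all_order all_algebra finmap.
From mathcomp Require Import all_classical all_reals all_analysis.
From mathcomp Require Import zify lra.

(** Fix a base point in each of the hyperbolic spaces. The orbit map turns the
    action of [G i] into a left-invariant pseudometric [d] on [G i] satisfying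
    the four-point condition and acylindricity, and all the geometry below takes
    place in that pseudometric. Write [len g] for the distance from [1] to [g]; it
    is at most linear in the word length.

    The map [Phi] sends [(h, k)] to [h x k], where [x] runs over a finite subset
    of [H] and is chosen so that, in every suitable factor, [x] is long and the
    path [1], [h], [h x], [h x k] hardly backtracks at its corners. Such a path
    is a quasigeodesic, so [h] and [h x] lie near a geodesic from [1] to
    [g = h x k]. Given [g] and a bound [n] on the word length of [k], the
    distance from [h x] to [g] takes O(n) values up to bounded error, and then
    [h] and [h x] are known up to bounded error; as they are far apart,
    acylindricity leaves boundedly many possibilities ([insertion_count]). So
    each factor contributes one linear term to a product, and the ambiguity is a
    polynomial of degree [#|I|] ([polynomial_ambiguity]).

    Which factors are suitable is decided by a dichotomy
    ([linear_or_selective]). Let [b] be a loxodromic element of the projection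
    [A] of [H]. The elements of [A] fixing an endpoint of the axis of [b] are
    counted by following the axis far enough ([stabilizer_count]): there are
    O(l) of them of length at most [l]. If the [A]-orbit of one of the two
    endpoints is finite, all of [A] therefore grows linearly, so that [k] itself
    has O(n) possible projections, whatever [x] is. Otherwise there are elements
    [c_t] and [e_t] of [A] moving the two endpoints to many distinct points, and
    the elements [c_t b ^+ M e_t ^-1] point in many different directions, as do
    their inverses. Given a number of directions to avoid, one of these elements
    avoids them all.

    A single [x] has to serve all the suitable factors. Rather than looking for
    an element acting loxodromically on every space, [simultaneous_selection]
    adds one factor at a time, replacing the finite set by products [x y x']: in
    the old factors the flanks [x] and [x'] determine both directions of the
    product, in the new one they are bounded and [y] determines them.

    Finally [Phi] gives [beta m * beta n <= f n * beta (m + n + eps)] for the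
    relative growth function [beta]. Since [f] is polynomial, [ln beta] is
    superadditive up to negligible defects, and Fekete's argument
    ([almost_superadditive_cvg]) yields the limit. *)

Import Order.TTheory GRing.Theory Num.Theory.
Import numFieldNormedType.Exports.

Set Implicit Arguments.
Unset Strict Implicit.
Unset Printing Implicit Defensive.

Local Open Scope classical_set_scope.
Local Open Scope ring_scope.

(** * Bounding cardinalities by duplicate-free lists *)

(** Finiteness is not known in advance for the sets counted below, and lists
    make covering arguments elementary. *)
Definition at_most (T : eqType) (n : nat) (A : set T) : Prop :=
  forall s : seq T, uniq s -> (forall x, x \in s -> A x) -> (size s <= n)%N.

Lemma card_le_at_most (T : choiceType) (A : set T) n :
  (A #<= `I_n)%card -> at_most n A.
Proof.
move=> An s us sA.
have fA : finite_set A by apply: card_le_finite An _; exact: finite_II.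
apply: leq_trans (geq_card_fset_set An); apply: uniq_leq_size => // x xs.
by rewrite in_fset_set // inE; exact: sA.
Qed.

Lemma at_most_card_le (T : choiceType) (A : set T) n :
  at_most n A -> (A #<= `I_n)%card.
Proof.
move=> An.
have [fA|/(@infinite_set_fset _ _ n.+1)[X XA]] := pselect (finite_set A).
  have /finite_setP[m Am] := fA.
  rewrite (card_le_eql Am) card_le_II -(card_fset_set Am).
  by apply: An (fset_uniq _) _ => x; rewrite in_fset_set // inE.
by rewrite ltnNge An ?fset_uniq // => x xX; exact: XA.
Qed.

Section AtMost.
Context {T : eqType}.
Implicit Types (A B : set T) (n : nat).

Lemma at_most_sub A B m n :
  A `<=` B -> (m <= n)%N -> at_most m B -> at_most n A.
Proof.
by move=> AB mn Bm s us sA; apply: leq_trans mn; apply: Bm => // x /sA/AB.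
Qed.

Lemma at_most_leq A m n : (m <= n)%N -> at_most m A -> at_most n A.
Proof. by move=> mn Am s us sA; apply: leq_trans mn; exact: Am. Qed.

Lemma at_most_local A n : (forall t, A t -> at_most n A) -> at_most n A.
Proof.
by move=> An [|t s] // us sA; apply: (An t) => //; apply: sA; rewrite mem_head.
Qed.

Lemma at_most_cover (J : eqType) (js : seq J) (B : J -> set T) A n :
    (forall t, A t -> exists2 j, j \in js & B j t) ->
    (forall j, j \in js -> at_most n (B j)) ->
  at_most (size js * n) A.
Proof.
elim: js A => [|j js IH] A cov Bn s us sA.
  by case: s sA {us} => // x s /(_ x (mem_head _ _))/cov[].
rewrite mulSn -(count_predC (fun x => `[< B j x >])) -!size_filter leq_add //.
  apply: (Bn j); rewrite ?mem_head ?filter_uniq // => x.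
  by rewrite mem_filter => /andP[/asboolP].
apply: (IH (A `\` B j)); rewrite ?filter_uniq //.
- move=> t [/cov[k + Bk] nB]; rewrite inE => /predU1P[kj|kjs]; last by exists k.
  by rewrite kj in Bk.
- by move=> k kjs; apply: Bn; rewrite inE kjs orbT.
- move=> x; rewrite mem_filter => /andP[/asboolPn nB /sA Ax]; by split.
Qed.

Lemma at_most_cover_nat (B : nat -> set T) A k n :
    (forall t, A t -> exists2 j, (j < k)%N & B j t) ->
    (forall j, (j < k)%N -> at_most n (B j)) ->
  at_most (k * n) A.
Proof.
move=> cov Bn; rewrite -[k](size_iota 0); apply: (at_most_cover (B := B)).
  by move=> t /cov[j jk Bj]; exists j; rewrite ?mem_iota.
by move=> j; rewrite mem_iota => /= jk; exact: Bn.
Qed.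

Lemma at_most_inj (U : eqType) (f : T -> U) A (B : set U) n :
    (forall x y, A x -> A y -> f x = f y -> x = y) ->
    (forall x, A x -> B (f x)) -> at_most n B -> at_most n A.
Proof.
move=> fI fB Bn s us sA; rewrite -(size_map f); apply: Bn.
  by rewrite map_inj_in_uniq // => x y /sA Ax /sA Ay; exact: fI.
by move=> _ /mapP[x /sA Ax ->]; exact: fB.
Qed.

End AtMost.

Lemma at_most_enum (T : choiceType) (A : set T) n :
    at_most n A ->
  exists2 js : seq T, (size js <= n)%N & forall x, A x -> x \in js.
Proof.
move=> An; have /card_le_finite fA := at_most_card_le An.
exists (fset_set A); last by move=> x Ax; rewrite in_fset_set ?inE //; exact: fA.
exact: geq_card_fset_set (at_most_card_le An).
Qed.

(** Exploring one coordinate at a time bounds a set whose elements are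
    determined by finitely many coordinates with few values each. *)
Lemma at_most_coordinates (T I : eqType) (U : I -> choiceType)
    (c : forall i, T -> U i) (r : seq I) (A : set T) n :
    (forall x y, A x -> A y -> (forall i, i \in r -> c i x = c i y) -> x = y) ->
    (forall i, i \in r -> at_most n (c i @` A)) ->
  at_most (n ^ size r) A.
Proof.
elim: r A => [|i r IH] A sep An.
  move=> [|x [|y s]] // /andP[xy _] sA; case/negP: xy.
  by rewrite (sep x y) ?mem_head //; apply: sA; rewrite !inE eqxx ?orbT.
have [js js_n jsP] := at_most_enum (An i (mem_head _ _)).
apply: (@at_most_leq _ _ (size js * n ^ size r)).
  by rewrite expnS leq_mul2r js_n orbT.
apply: (at_most_cover (B := fun j => A `&` [set t | c i t = j])).
  by move=> t At; exists (c i t) => //; apply: jsP; exists t.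
move=> j _; apply: IH.
  move=> x y [Ax xj] [Ay yj] xy; apply: sep => // k.
  rewrite inE => /predU1P[->|].
    by rewrite xj yj.
  exact: xy.
move=> k kr; apply: (@at_most_sub _ _ _ n n _ _ (An k _)) => //.
  by move=> _ [t [At _] <-]; exists t.
by rewrite inE kr orbT.
Qed.

Lemma real_lt_nat {R : realType} (x : R) : exists n : nat, x < n%:R.
Proof. by exists (Num.trunc x).+1; exact: truncnS_gt. Qed.

Lemma nat_bound {R : realType} (T : eqType) (s : seq T) (f : T -> R) :
  exists M : nat, forall x, x \in s -> f x <= M%:R.
Proof.
elim: s => [|x s [M IH]]; first by exists 0%N.
exists (maxn (Num.trunc (f x)).+1 M) => y; rewrite inE => /predU1P[->|/IH yM].
  by rewrite (le_trans (ltW (truncnS_gt _))) // ler_nat leq_maxl.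
by rewrite (le_trans yM) // ler_nat leq_maxr.
Qed.

(** * Hyperbolic left-invariant pseudometrics on a group *)

Section HyperbolicMetric.
Context {R : realType} {G : groupType}.
Implicit Types (d : G -> G -> R) (delta : R).

(** Hyperbolicity in the form of the four-point condition: the largest two of
    the three sums of opposite distances differ by at most [delta], which is
    twice the constant of the Gromov product inequality. *)
Record hyperbolic_metric d delta : Prop := HyperbolicMetric {
  hm_refl : forall x, d x x = 0;
  hm_sym : forall x y, d x y = d y x;
  hm_triangle : forall x y z, d x z <= d x y + d y z;
  hm_left : forall g x y, d (g * x)%g (g * y)%g = d x y;
  hm_four : forall x y z w,
    d x z + d y w <= d x y + d z w + delta \/
    d x z + d y w <= d y z + d x w + delta }.

Definition acylindrical_metric d : Prop :=
  forall eps, 0 < eps -> exists (rho : R) (N : nat), forall c, rho <= d 1%g c ->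
    at_most N [set u | d 1%g u <= eps /\ d c (u * c)%g <= eps].

(** Twice the Gromov product of [x] and [y] at [w]. *)
Definition gromov d (w x y : G) : R := d w x + d w y - d x y.

Context {d : G -> G -> R} {delta : R}.
Hypothesis dH : hyperbolic_metric d delta.
Local Notation len := (d 1%g).

Let dxx := hm_refl dH.
Let dC := hm_sym dH.
Let dT := hm_triangle dH.
Let dL := hm_left dH.

Lemma hm_ge0 x y : 0 <= d x y.
Proof. by have := dT x y x; rewrite dxx (dC y x); lra. Qed.

Lemma hm_delta_ge0 : 0 <= delta.
Proof. by case: (hm_four dH 1%g 1%g 1%g 1%g); rewrite !dxx; lra. Qed.

Lemma hm_len x y : d x y = len (x^-1 * y)%g.
Proof. by rewrite -[RHS](dL x) mulg1 mulVKg. Qed.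

Lemma hm_lenV x : len (x^-1)%g = len x.
Proof. by rewrite -[LHS](dL x) mulg1 mulgV dC. Qed.

Lemma hm_mulr x y : d x (x * y)%g = len y.
Proof. by rewrite -{1}[x]mulg1 dL. Qed.

Lemma hm_lenM x y : len (x * y)%g <= len x + len y.
Proof. by rewrite -(hm_mulr x y); exact: dT. Qed.

Lemma gromovC w x y : gromov d w x y = gromov d w y x.
Proof. by rewrite /gromov (dC x y); lra. Qed.

Lemma gromov_left g w x y :
  gromov d (g * w)%g (g * x)%g (g * y)%g = gromov d w x y.
Proof. by rewrite /gromov !dL. Qed.

Lemma gromov_hyperbolic x y z w :
  gromov d w x y <= gromov d w x z + delta \/
  gromov d w y z <= gromov d w x z + delta.
Proof.
rewrite /gromov (dC w x) (dC w z).
by case: (hm_four dH x y z w) => h; [left|right]; move: h; rewrite (dC w y); lra.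
Qed.

Lemma gromov_moveR w x y y' : gromov d w x y <= gromov d w x y' + 2 * d y y'.
Proof.
by have := dT w y' y; have := dT x y y'; rewrite /gromov (dC y' y); lra.
Qed.

Lemma gromov_move w x y x' y' :
  gromov d w x y <= gromov d w x' y' + 2 * d x x' + 2 * d y y'.
Proof.
have := gromov_moveR w x y y'; have := gromov_moveR w y' x x'.
by rewrite !(gromovC w y'); lra.
Qed.

Lemma gromov_move_base w w' x y : gromov d w x y <= gromov d w' x y + 2 * d w w'.
Proof. by have := dT w w' x; have := dT w w' y; rewrite /gromov; lra. Qed.

End HyperbolicMetric.

Arguments hm_refl {R G d delta}.
Arguments hm_sym {R G d delta}.
Arguments hm_triangle {R G d delta}.
Arguments hm_left {R G d delta}.
Arguments hm_four {R G d delta}.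

(** * The axis of a loxodromic element *)

Section Axis.
Context {R : realType} {G : groupType} {d : G -> G -> R} {delta : R}.
Hypothesis dH : hyperbolic_metric d delta.
Local Notation len := (d 1%g).

Let dxx := hm_refl dH.
Let dC := hm_sym dH.
Let dT := hm_triangle dH.
Let dL := hm_left dH.
Let d_ge0 := hm_ge0 dH.
Let delta_ge0 := hm_delta_ge0 dH.

(** A local condition which forces the powers of [b] to run along a
    quasigeodesic with explicit constants. *)
Definition axial (b : G) : Prop := len b + 2 * delta + 1 <= len (b ^+ 2)%g.

Lemma axialV b : axial b -> axial b^-1.
Proof. by rewrite /axial expVgn !(hm_lenV dH). Qed.

(** Iterated doubling: were each squaring to lengthen [g ^+ (2 ^ k)] by only a
    bounded amount, lengths would grow logarithmically. *)
Lemma axial_power g (lambda c : R) :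
    0 < lambda -> (forall n : nat, n%:R / lambda - c <= len (g ^+ n)%g) ->
  exists n, axial (g ^+ n).
Proof.
move=> l0 glin; apply: contrapT => noax.
set kap := 2 * delta + 1.
have dbl n : len (g ^+ (n * 2))%g < len (g ^+ n)%g + kap.
  rewrite ltNge; apply/negP => le; apply: noax; exists n.
  by move: le; rewrite /axial /kap expgnA; lra.
have up k : len (g ^+ (2 ^ k))%g <= len g + k%:R * kap.
  elim: k => [|k IH]; first by rewrite mul0r addr0 expn0 expg1.
  by rewrite expnSr -natr1; have := dbl (2 ^ k)%N; lra.
pose a := lambda * (`|c| + len g + 2 * kap).
have [j ja] := real_lt_nat a.
have kap0 : 0 < kap by rewrite /kap; have := delta_ge0; lra.
have := glin (2 ^ (j * 2))%N; have := up (j * 2)%N.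
have j2 : j.+1%:R * j.+1%:R <= (2 ^ (j * 2))%N%:R :> R.
  by rewrite -natrM ler_nat expnM -mulnn leq_mul // ltn_expl.
move=> h1 h2.
have h3 : (2 ^ (j * 2))%N%:R / lambda <= `|c| + len g + (j * 2)%:R * kap.
  by have := ler_norm c; lra.
move: h3; rewrite ler_pdivrMr // => h3.
have g0 : 0 <= len g by exact: d_ge0.
have c0 := normr_ge0 c.
move: j2 ja h3; rewrite /a natrM -natr1.
set x := (j%:R : R) => j2 ja h3.
have x0 : 0 <= x by exact: ler0n.
pose u := lambda * (`|c| + len g); pose v := lambda * kap.
have u0 : 0 <= u by rewrite mulr_ge0 ?addr_ge0 // ltW.
have v0 : 0 <= v by rewrite mulr_ge0 // ltW.
have uvx : u + 2 * v < x by move: ja; rewrite /u /v /a; lra.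
have : (x + 1) * (x + 1) <= u + x * 2 * v.
  by apply: le_trans j2 (le_trans h3 _); rewrite /u /v; lra.
by nra.
Qed.

Section Powers.
Context {b : G} (bax : axial b).
Local Notation pow n := (len (b ^+ n)%g).

Let dpow i j : d (b ^+ i)%g (b ^+ (i + j))%g = pow j.
Proof. by rewrite expgnDr (hm_mulr dH). Qed.

(** Once the distance to [1] grows by more than [delta] from [b ^+ n] to
    [b ^+ n.+1], the four-point condition on [1] and three consecutive powers
    makes it grow again, since the point cannot turn back. *)
Lemma axial_step n : pow n + delta + 1 <= pow n.+1.
Proof.
elim: n => [|n IH].
  move: bax; rewrite /axial expg1 expg0 dxx expg2.
  have := hm_lenM dH b b; have := delta_ge0; lra.
have h := hm_four dH 1%g (b ^+ n)%g (b ^+ n.+1)%g (b ^+ n.+2)%g.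
have d0 := delta_ge0.
have := dpow n 2; have := dpow n 1; have := dpow n.+1 1.
rewrite !addn1 addn2 expg1 => h1 h2 h3.
by move: bax IH; rewrite /axial; case: h; lra.
Qed.

Lemma axial_pow_ge n : n%:R <= pow n.
Proof.
elim: n => [|n IH]; first by rewrite expg0 dxx.
by have := axial_step n; have := delta_ge0; rewrite -natr1; lra.
Qed.

Lemma axial_pow_le n : pow n <= n%:R * len b.
Proof.
elim: n => [|n IH]; first by rewrite expg0 dxx mul0r.
by rewrite expgS -natr1; have := hm_lenM dH b (b ^+ n)%g; lra.
Qed.

Lemma axial_mono m n : (m <= n)%N -> pow m <= pow n.
Proof.
move=> /subnK <-; elim: (n - m)%N => [|k IH]; first by rewrite add0n.
by rewrite addSn; have := axial_step (k + m)%N; have := delta_ge0; lra.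
Qed.

(** The powers of [b] run along a geodesic up to bounded error: the left-hand
    side is twice the Gromov product of [1] and [b ^+ (i + j)] at [b ^+ i], and
    the growth in [axial_step] excludes one of the two cases of the four-point
    condition on [1], [b ^+ i], [b ^+ i.+1] and [b ^+ (i + j)]. *)
Lemma axial_straight i j : pow i + pow j - pow (i + j)%N <= len b + delta.
Proof.
case: j => [|j].
  by rewrite addn0 expg0 dxx; have := d_ge0 1%g b; have := delta_ge0; lra.
have h := hm_four dH 1%g (b ^+ i)%g (b ^+ i.+1)%g (b ^+ (i + j.+1))%g.
have := dpow i 1; have := dpow i.+1 j; have := dpow i j.+1.
rewrite addn1 addSnnS expg1 => h1 h2 h3.
have := axial_step i; have := axial_step j; have := delta_ge0.
by case: h; lra.
Qed.

End Powers.
End Axis.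

(** * Elements carrying one ray of an axis near another *)

Section FellowTravel.
Context {R : realType} {G : groupType} {d : G -> G -> R} {delta : R}.
Hypothesis dH : hyperbolic_metric d delta.
Local Notation len := (d 1%g).

Let dxx := hm_refl dH.
Let dC := hm_sym dH.
Let dT := hm_triangle dH.
Let dL := hm_left dH.
Let d_ge0 := hm_ge0 dH.
Let delta_ge0 := hm_delta_ge0 dH.

(** Boundedness of these Gromov products means that the rays [c, c b, ...] and
    [c', c' b, ...] have different endpoints at infinity. *)
Definition divergent (b c c' : G) : Prop :=
  exists K, forall m n, gromov d 1%g (c * b ^+ m)%g (c' * b ^+ n)%g <= K.

Lemma divergent_left b c c' : divergent b 1%g (c^-1 * c')%g -> divergent b c c'.
Proof.
move=> [K bK]; exists (K + 2 * len c) => m n; have := bK m n.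
rewrite mul1g -(gromov_left dH c) mulg1 !mulgA mulgV mul1g => h.
by have := gromov_move_base dH 1%g c (c * b ^+ m)%g (c' * b ^+ n)%g; lra.
Qed.

Context {b : G} (bax : axial (d := d) (delta := delta) b).
Local Notation pow n := (len (b ^+ n)%g).

Lemma axial_dist_ge i j : (j - i)%N%:R <= d (b ^+ i)%g (b ^+ j)%g.
Proof.
have [/eqP ->|/ltnW ij] := leqP j i; first exact: d_ge0.
rewrite -{2}(subnKC ij) expgnDr (hm_mulr dH).
exact: (axial_pow_ge dH bax).
Qed.

Lemma axial_level r : 0 <= r -> exists j, pow j <= r < pow j + len b.
Proof.
move=> r0; have [n nr] := real_lt_nat r.
have ex : exists j, r < pow j.+1.
  exists n; apply: lt_le_trans nr (le_trans _ (axial_pow_ge dH bax _)).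
  by rewrite ler_nat.
exists (ex_minn ex); case: ex_minnP => j rj jmin; apply/andP; split.
  case: j rj jmin => [|j] _ jmin; first by rewrite expg0 dxx.
  by rewrite leNgt; apply/negP => /jmin; rewrite ltnn.
by apply: lt_le_trans rj _; rewrite expgSr; exact: hm_lenM dH _ _.
Qed.

(** Let [y] and [b ^+ m] be far away points near the common endpoint of the ray
    from [e] and of the axis ray. After a time controlled by [len e], the point
    [P = e b ^+ j] is near a geodesic from [1] to [y], hence near one from [1]
    to [b ^+ m], and it is compared with the power of [b] at the same distance
    from [1]. *)
Lemma fellow_travel e j : ~ divergent b 1%g e ->
    2 * len e + len b + 2 * delta < 2 * pow j ->
  exists j', pow j' <= len e + pow j /\
    d (e * b ^+ j)%g (b ^+ j')%g <= 3 * len b + 4 * delta.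
Proof.
move=> ediv jbig; set P := (e * b ^+ j)%g.
pose K := 2 * (len e + pow j).
have [m [n Kmn]] : exists m n, K < gromov d 1%g (b ^+ m)%g (e * b ^+ n)%g.
  apply: contrapT => no; apply: ediv; exists K => m n; rewrite mul1g leNgt.
  by apply/negP => h; apply: no; exists m, n.
set y := (e * b ^+ n)%g in Kmn.
have P_le : len P <= len e + pow j by exact: hm_lenM dH _ _.
have y_le : len y <= len e + pow n by exact: hm_lenM dH _ _.
have jn : (j <= n)%N.
  rewrite leqNgt; apply/negP => /ltnW /(axial_mono dH bax).
  have := dT 1%g y (b ^+ m)%g; rewrite (dC y); move: Kmn.
  by rewrite /K /gromov; lra.
have eP : d e P = pow j by rewrite /P (hm_mulr dH).
have Py : d P y = pow (n - j)%N.
  by rewrite /P /y dL -{1}(subnKC jn) expgnDr (hm_mulr dH).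
have yP : gromov d P e y <= len b + delta.
  have := axial_straight dH bax j (n - j).
  by rewrite subnKC // /gromov Py (dC P e) eP /y (hm_mulr dH); lra.
have yoP : gromov d P 1%g y <= len b + 2 * delta.
  have := gromov_hyperbolic dH e 1%g y P; move: yP.
  have := dT e 1%g P; move: jbig.
  rewrite /gromov (dC P 1%g) (dC P e) (dC e 1%g) eP.
  by move=> h1 h2 h3 [] h4; lra.
have Pm : 2 * len P - len b - 3 * delta <= gromov d 1%g P (b ^+ m)%g.
  have := gromov_hyperbolic dH P y (b ^+ m)%g 1%g; move: yoP Kmn.
  have := delta_ge0; have := d_ge0 1%g b.
  by rewrite /K /gromov (dC P 1%g) (dC y (b ^+ m)%g) => b0 d0 h1 h2 [] h3; lra.
have [j' /andP[j'P Pj']] := axial_level (d_ge0 1%g P).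
exists j'; split; first by lra.
have j'm : (j' <= m)%N.
  rewrite leqNgt; apply/negP => /ltnW /(axial_mono dH bax).
  have := dT 1%g (b ^+ m)%g y; move: Kmn.
  by rewrite /K /gromov; lra.
have := axial_straight dH bax j' (m - j'); rewrite subnKC // => st.
have j'mE : d (b ^+ j')%g (b ^+ m)%g = pow (m - j')%N.
  by rewrite -{1}(subnKC j'm) expgnDr (hm_mulr dH).
have := gromov_hyperbolic dH P (b ^+ m)%g (b ^+ j')%g 1%g.
move: Pm; rewrite /gromov (dC (b ^+ m)%g (b ^+ j')%g) j'mE.
have := delta_ge0; have := d_ge0 1%g b.
by move=> h0 h1 h2 [] h3; lra.
Qed.

Hypothesis d_acyl : acylindrical_metric d.

(** Elements sending the endpoint of the axis ray to itself are described up to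
    boundedly many choices by where they carry two far away points of the ray,
    and acylindricity bounds the ambiguity that remains. *)
Lemma stabilizer_count : exists F : nat, forall l : nat,
  at_most (F * l.+1)%N [set e | ~ divergent b 1%g e /\ len e <= l%:R].
Proof.
pose D := 3 * len b + 4 * delta.
have b0 := d_ge0 1%g b; have d0 := delta_ge0.
have D0 : 0 <= D by rewrite /D; lra.
have [rho [N acyl]] := d_acyl (eps := 2 * D + 1) ltac:(lra).
(* [b ^+ j] and [b ^+ (j + N0)] are far enough apart for acylindricity, and [Q]
   bounds the distance between their images along the axis *)
have [N0 N0rho] := real_lt_nat rho.
have [B bB] := real_lt_nat (len b).
have [Q QP] := real_lt_nat (2 * D + N0%:R * len b).
have [c0 c0P] := real_lt_nat (len b + 2 * delta).
exists ((1 + B * (1 + c0)).+1 * (2 * Q).+1 * N)%N => l.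
(* late enough for [fellow_travel] whenever [len e <= l] *)
pose j := (l + c0)%N.
pose near e i k := d (e * b ^+ i)%g (b ^+ k)%g <= D.
apply: (@at_most_leq _ _ ((1 + B * (1 + c0)).+1 * l.+1 * ((2 * Q).+1 * N))).
  by apply: eq_leq; clear; lia.
have jlen e i : ~ divergent b 1%g e -> len e <= l%:R -> (j <= i)%N ->
    exists j', pow j' <= len e + pow i /\ near e i j'.
  move=> ediv el ji; apply: fellow_travel => //.
  have := axial_pow_ge dH bax i; have : j%:R <= i%:R :> R by rewrite ler_nat.
  by rewrite /j natrD; lra.
apply: (at_most_cover_nat (B := fun k => [set e | near e j k /\
    exists k', [/\ (k <= k' + Q)%N, (k' <= k + Q)%N & near e (j + N0) k']])).
  move=> e /= [ediv el]; have [k [kj ek]] := jlen e j ediv el (leqnn _).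
  have [k' [_ ek']] := jlen e (j + N0)%N ediv el (leq_addr _ _).
  exists k.
    rewrite -(ltr_nat R) !natrM; apply: le_lt_trans (axial_pow_ge dH bax k) _.
    have h1 := axial_pow_le dH (b := b) j.
    have h2 : j%:R * len b <= j%:R * B%:R by rewrite ler_wpM2l // ltW.
    have : (l + j * B)%:R < ((1 + B * (1 + c0)).+1 * l.+1)%:R :> R.
      by rewrite ltr_nat /j; clear; nia.
    by rewrite natrD !natrM; lra.
  split=> //; exists k'.
  have kk' : d (b ^+ k)%g (b ^+ k')%g < Q%:R.
    have := dT (b ^+ k)%g (e * b ^+ j)%g (b ^+ k')%g.
    have := dT (e * b ^+ j)%g (e * b ^+ (j + N0))%g (b ^+ k')%g.
    rewrite dL (expgnDr b j) (hm_mulr dH) -(expgnDr b j).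
    rewrite (dC (b ^+ k)%g (e * _)%g).
    have := axial_pow_le dH (b := b) N0.
    by move: ek ek'; rewrite /near; lra.
  have h1 := le_lt_trans (axial_dist_ge k k') kk'.
  rewrite dC in kk'; have h2 := le_lt_trans (axial_dist_ge k' k) kk'.
  move: h1 h2; rewrite !ltr_nat => h1 h2.
  by split=> //; clear -h1 h2; lia.
move=> k _.
(* [q] encodes [k' - k], which lies between [- Q] and [Q] *)
apply: (at_most_cover_nat (B := fun q => [set e | near e j k /\
    exists k', (k' + Q = k + q)%N /\ near e (j + N0) k'])).
  move=> e /= [ek [k' [h1 h2 ek']]]; exists (k' + Q - k)%N.
    by clear -h2; lia.
  by split=> //; exists k'; split=> //; clear -h1; lia.
move=> q _; apply: at_most_local => e /= [ek [k' [kk' ek']]].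
apply: (at_most_inj (f := fun e' => ((e * b ^+ j)^-1 * (e' * b ^+ j))%g)
         _ _ (acyl (b ^+ N0)%g _)).
- by move=> x y _ _ /= /mulgI/mulIg.
- move=> e' /= [e'k [k'' [kk'' e'k']]].
  have {}kk'' : k'' = k' by clear -kk' kk''; lia.
  rewrite {}kk'' in e'k'; rewrite -(hm_len dH); split=> /=.
    have := dT (e * b ^+ j)%g (b ^+ k)%g (e' * b ^+ j)%g.
    by move: ek e'k; rewrite /near (dC (b ^+ k)%g (e' * _)%g); lra.
  have -> : ((e * b ^+ j)^-1 * (e' * b ^+ j) * b ^+ N0 =
             (e * b ^+ j)^-1 * (e' * b ^+ (j + N0)))%g.
    by rewrite (expgnDr b j) !mulgA.
  rewrite -[leLHS](dL (e * b ^+ j)%g) mulVKg -mulgA -(expgnDr b j).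
  have := dT (e * b ^+ (j + N0))%g (b ^+ k')%g (e' * b ^+ (j + N0))%g.
  by move: ek' e'k'; rewrite /near (dC (b ^+ k')%g (e' * _)%g); lra.
- exact: le_trans (ltW N0rho) (axial_pow_ge dH bax _).
Qed.

(** The elements carrying the endpoint of the axis ray to that of the ray from
    [c] form a coset of a set counted by [stabilizer_count]. *)
Lemma linear_count_of_finite_orbit (A : set G) (cs : seq G) :
    (forall h, A h -> exists2 c, c \in cs & ~ divergent b c h) ->
  exists F : nat, forall l : nat,
    at_most (F * l.+1)%N [set h | A h /\ len h <= l%:R].
Proof.
move=> cov; have [F FP] := stabilizer_count.
have [M MP] := nat_bound cs (fun c => len c).
exists (size cs * (F * M.+1))%N => l.
apply: (@at_most_leq _ _ (size cs * (F * (l + M).+1))).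
  by rewrite -!mulnA !leq_mul //; nia.
apply: (at_most_cover
  (B := fun c => [set h | ~ divergent b c h /\ len h <= l%:R])).
  by move=> h /= [/cov[c cs_c hc] hl]; exists c.
move=> c cs_c; apply: (at_most_inj (f := fun h => (c^-1 * h)%g) _ _ (FP _)).
  by move=> x y _ _ /= /mulgI.
move=> h /= [hc hl]; split; first by apply: contra_not hc; exact: divergent_left.
have := hm_lenM dH c^-1%g h; rewrite (hm_lenV dH) natrD.
by have := MP _ cs_c; lra.
Qed.

End FellowTravel.

(** * Selecting long elements that avoid given directions *)

(** A greedy extension fails only when every element is related to one already
    chosen. *)
Lemma independent_or_covered (T : choiceType) (A : set T)
    (sep : T -> T -> Prop) :
  (exists cs : seq T, forall x, A x -> exists2 c, c \in cs & ~ sep c x) \/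
  (forall r : nat, exists c : nat -> T, (forall i, (i < r)%N -> A (c i)) /\
    forall i j, (i < j < r)%N -> sep (c i) (c j)).
Proof.
have [cov|nocov] :=
  pselect (exists cs : seq T, forall x, A x -> exists2 c, c \in cs & ~ sep c x).
  by left.
right.
have next (cs : seq T) : exists x, A x /\ forall c, c \in cs -> sep c x.
  apply: contrapT => no; apply: nocov; exists cs => x Ax; apply: contrapT => no'.
  apply: no; exists x; split=> // c ccs; apply: contrapT => nsep.
  by apply: no'; exists c.
elim=> [|r [c [cA csep]]].
  have [x _] := next [::].
  by exists (fun=> x); split=> // i j; rewrite ltn0 andbF.
have [x [Ax xsep]] := next [seq c i | i <- iota 0 r].
exists (fun i => if (i < r)%N then c i else x); split=> [i _|i j /andP[ij]].
  by case: ifP => // /cA.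
rewrite ltnS => jr; rewrite (leq_trans ij jr); case: ifP => jr'.
  by apply: csep; rewrite ij.
by apply: xsep; apply: map_f; rewrite mem_iota /= (leq_trans ij jr).
Qed.

Lemma uniform_bound {R : realType} (T : eqType) (s : seq T) (P : T -> R -> Prop) :
    (forall x K K', P x K -> K <= K' -> P x K') ->
    (forall x, x \in s -> exists K, P x K) ->
  exists K, forall x, x \in s -> P x K.
Proof.
move=> mono; elim: s => [|x s IH] ex; first by exists 0.
have [K0 PK0] := ex x (mem_head _ _).
have [|K1 PK1] := IH; first by move=> y ys; apply: ex; rewrite inE ys orbT.
exists (Num.max K0 K1) => y; rewrite inE => /predU1P[->|/PK1 h].
  by apply: mono PK0 _; rewrite le_max lexx.
by apply: mono h _; rewrite le_max lexx orbT.
Qed.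

Section Selective.
Context {R : realType} {G : groupType}.

(** Having infinitely many directions at both ends, in the form in which it is
    used: the bound [K] on Gromov products comes before the length [L], because
    acylindricity determines from [K] how long the element has to be. *)
Definition selective (d : G -> G -> R) (A : set G) : Prop :=
  forall q : nat, exists K : R, forall L : R, exists Y : seq G,
    (forall y, y \in Y -> A y) /\
    forall Z W : seq G, (size Z + size W <= q)%N ->
      exists y, [/\ y \in Y, L <= d 1%g y,
        forall z, z \in Z -> gromov d 1%g y z <= K &
        forall w, w \in W -> gromov d 1%g y^-1%g w <= K].

Context {d : G -> G -> R} {delta : R}.
Hypothesis dH : hyperbolic_metric d delta.
Local Notation len := (d 1%g).

Let dC := hm_sym dH.

Lemma divergent_uniform b (r : nat) (c : nat -> G) :
    (forall i j, (i < j < r)%N -> divergent (d := d) b (c i) (c j)) ->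
  exists K, forall i j m n, (i < r)%N -> (j < r)%N -> i != j ->
    gromov d 1%g (c i * b ^+ m)%g (c j * b ^+ n)%g <= K.
Proof.
move=> cdiv.
have [[x y] K K' h KK' m n|[i j] _|K KP] := @uniform_bound _ _
  [seq (i, j) | i <- iota 0 r, j <- iota 0 r]
  (fun p K => forall m n, (p.1 < p.2 < r)%N ->
     gromov d 1%g (c p.1 * b ^+ m)%g (c p.2 * b ^+ n)%g <= K).
- by move=> /h hh; apply: le_trans (hh _ _) KK'.
- by have [/cdiv[K KP]|no] := boolP (i < j < r)%N; [exists K => m n _|exists 0].
exists K => i j m n ir jr; rewrite neq_ltn => /orP[ij|ij].
  by apply: (KP (i, j)); rewrite ?ij //; apply: allpairs_f; rewrite mem_iota.
rewrite (gromovC dH); apply: (KP (j, i)); rewrite /= ?ij //.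
by apply: allpairs_f; rewrite mem_iota.
Qed.

(** Each test point is close in direction to at most one of many elements with
    pairwise different directions, so some element passes all the tests. *)
Lemma selective_pigeonhole (y : nat -> G) (K : R) (q : nat) (Z W : seq G) :
    (forall s t, (s < q.+1)%N -> (t < q.+1)%N -> s != t ->
       gromov d 1%g (y s) (y t) <= K /\
       gromov d 1%g (y s)^-1%g (y t)^-1%g <= K) ->
    (size Z + size W <= q)%N ->
  exists2 t, (t < q.+1)%N &
    (forall z, z \in Z -> gromov d 1%g (y t) z <= K + delta) /\
    (forall w, w \in W -> gromov d 1%g (y t)^-1%g w <= K + delta).
Proof.
move=> ysep ZW; apply: contrapT => no.
pose js : seq (G + G) := map inl Z ++ map inr W.
pose blocked j t := match j with
  | inl z => K + delta < gromov d 1%g (y t) z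
  | inr w => K + delta < gromov d 1%g (y t)^-1%g w end.
suff : at_most (size js * 1) [set t | (t < q.+1)%N].
  move=> /(_ (iota 0 q.+1)); rewrite iota_uniq size_iota muln1 size_cat !size_map.
  move=> h; have : (q < size Z + size W)%N by apply: h => // t; rewrite mem_iota.
  by rewrite ltnNge ZW.
apply: (at_most_cover (B := fun j => [set t | (t < q.+1)%N /\ blocked j t])).
  move=> /= t tq; apply: contrapT => nobl; apply: no; exists t => //.
  split=> z zZ; rewrite leNgt; apply/negP => zbl; apply: nobl.
    by exists (inl z); rewrite /js ?mem_cat ?map_f.
  by exists (inr z); rewrite /js ?mem_cat ?map_f ?orbT.
move=> j _ [|s [|t r]] //= /andP[st _] bl.
have [sq sj] := bl s (mem_head _ _).
have [tq tj] := bl t ltac:(by rewrite !inE eqxx orbT).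
have [h1 h2] : gromov d 1%g (y s) (y t) <= K /\
    gromov d 1%g (y s)^-1%g (y t)^-1%g <= K.
  by apply: ysep => //; apply: contraNneq st => ->; rewrite mem_head.
case: j sj tj {bl} => [z|w] /=.
  have := gromov_hyperbolic dH (y s) z (y t) 1%g.
  by rewrite (gromovC dH _ z); case; lra.
have := gromov_hyperbolic dH (y s)^-1%g w (y t)^-1%g 1%g.
by rewrite (gromovC dH _ w); case; lra.
Qed.

(** The elements [c b ^+ M e^-1], for large [M], point towards the endpoint of
    the ray from [c], and their inverses towards that of the ray of [b^-1] from
    [e]. *)
Lemma selective_of_infinite_orbits (A : set G) b :
    (forall x y, A x -> A y -> A (x * y)%g) -> (forall x, A x -> A x^-1%g) ->
    A 1%g -> A b -> axial (d := d) (delta := delta) b ->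
    (forall r : nat, exists c : nat -> G, (forall i, (i < r)%N -> A (c i)) /\
       forall i j, (i < j < r)%N -> divergent (d := d) b (c i) (c j)) ->
    (forall r : nat, exists c : nat -> G, (forall i, (i < r)%N -> A (c i)) /\
       forall i j, (i < j < r)%N -> divergent (d := d) b^-1 (c i) (c j)) ->
  selective d A.
Proof.
move=> AM AV A1 Ab bax plus minus q.
have [c [cA /divergent_uniform[Kc cP]]] := plus q.+1.
have [e [eA /divergent_uniform[Ke eP]]] := minus q.+1.
have [M0 M0c] := nat_bound (iota 0 q.+1) (fun i => len (c i)).
have [M1 M1e] := nat_bound (iota 0 q.+1) (fun i => len (e i)).
pose M01 : R := M0%:R + M1%:R.
have M0_ge0 : 0 <= M0%:R :> R by [].
have M1_ge0 : 0 <= M1%:R :> R by [].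
have cM i : (i < q.+1)%N -> len (c i) <= M0%:R.
  by move=> iq; apply: M0c; rewrite mem_iota.
have eM i : (i < q.+1)%N -> len (e i) <= M1%:R.
  by move=> iq; apply: M1e; rewrite mem_iota.
pose K := Num.max Kc Ke + 4 * M01.
have KcK : Kc <= Num.max Kc Ke by rewrite le_max lexx.
have KeK : Ke <= Num.max Kc Ke by rewrite le_max lexx orbT.
exists (K + delta) => L.
have [M LM] := real_lt_nat (L + M01).
pose y i := (c i * b ^+ M * (e i)^-1)%g.
have yV i : ((y i)^-1 = e i * b^-1 ^+ M * (c i)^-1)%g.
  by rewrite /y !invgM invgK mulgA expVgn.
have Abn n : A (b ^+ n)%g.
  by elim: n => [|n IH]; rewrite ?expg0 // expgS; exact: AM.
exists [seq y i | i <- iota 0 q.+1]; split.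
  move=> z /mapP[i]; rewrite mem_iota /= => iq ->.
  by apply: (AM); [apply: (AM); [exact: cA|] | apply: AV; exact: eA].
move=> Z W ZW; have [t tq [tZ tW]] : exists2 t, (t < q.+1)%N &
    (forall z, z \in Z -> gromov d 1%g (y t) z <= K + delta) /\
    (forall w, w \in W -> gromov d 1%g (y t)^-1%g w <= K + delta).
  apply: selective_pigeonhole ZW => s t sq tq st; split.
    have := gromov_move dH 1%g (y s) (y t) (c s * b ^+ M)%g (c t * b ^+ M)%g.
    rewrite /y !(dC _ (c _ * _)%g) !(hm_mulr dH) !(hm_lenV dH).
    have := cP s t M M sq tq st; have := eM s sq; have := eM t tq.
    by rewrite /K /M01; lra.
  rewrite !yV.
  have := gromov_move dH 1%g (e s * b^-1 ^+ M * (c s)^-1)%g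
    (e t * b^-1 ^+ M * (c t)^-1)%g (e s * b^-1 ^+ M)%g (e t * b^-1 ^+ M)%g.
  rewrite !(dC _ (e _ * _)%g) !(hm_mulr dH) !(hm_lenV dH).
  have := eP s t M M sq tq st; have := cM s sq; have := cM t tq.
  by rewrite /K /M01; lra.
exists (y t); split=> //; first by apply: map_f; rewrite mem_iota.
have := hm_lenM dH (c t)^-1%g (y t * e t)%g.
have := hm_lenM dH (y t) (e t); rewrite /y mulgVK mulgA mulVg mul1g (hm_lenV dH).
have := axial_pow_ge dH bax M; have := cM t tq; have := eM t tq.
by move: LM; rewrite /M01; lra.
Qed.

(** Either the orbit of one of the two endpoints of the axis is finite, whence
    linear growth, or both are infinite. *)
Lemma linear_or_selective (A : set G) b :
    (forall x y, A x -> A y -> A (x * y)%g) -> (forall x, A x -> A x^-1%g) ->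
    A 1%g -> A b ->
    axial (d := d) (delta := delta) b -> acylindrical_metric d ->
  (exists F : nat, forall l : nat,
     at_most (F * l.+1)%N [set h | A h /\ len h <= l%:R]) \/
  selective d A.
Proof.
move=> AM AV A1 Ab bax dA.
have [[cs cov]|plus] := independent_or_covered A (divergent (d := d) b).
  by left; exact: linear_count_of_finite_orbit dH _ bax dA _ _ cov.
have [[cs cov]|minus] := independent_or_covered A (divergent (d := d) b^-1).
  by left; apply: (linear_count_of_finite_orbit dH (axialV dH bax) dA cov).
by right; exact: (selective_of_infinite_orbits AM AV A1 Ab bax plus minus).
Qed.

End Selective.

(** * Inserting a long element between two others *)

Section Insertion.
Context {R : realType} {G : groupType} {d : G -> G -> R} {delta : R}.
Hypothesis dH : hyperbolic_metric d delta.
Local Notation len := (d 1%g).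

Let dC := hm_sym dH.
Let dL := hm_left dH.
Let d_ge0 := hm_ge0 dH.
Let delta_ge0 := hm_delta_ge0 dH.

(** Seen from [g], both points lie in the direction of [1], so that their Gromov
    product at [g] is almost as large as their distances to [g]. *)
Lemma near_geodesic_close g u u' C eta :
    gromov d u 1%g g <= C -> gromov d u' 1%g g <= C ->
    d u g <= d u' g + eta -> d u' g <= d u g + eta ->
  d u u' <= C + delta + eta.
Proof.
have := gromov_hyperbolic dH u 1%g u' g.
rewrite /gromov !(dC g) (dC u' 1%g) (dC u 1%g).
by case; lra.
Qed.

(** The path [1], [h], [h x], [h x k] hardly backtracks at [h] and at [h x], and
    its middle segment is too long for the two small defects to interact, so it
    follows a geodesic. *)
Lemma aligned_insertion h x k C :
    gromov d 1%g h^-1%g x <= C -> gromov d 1%g x^-1%g k <= C ->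
    2 * C + delta < 2 * len x ->
  gromov d h 1%g (h * x * k)%g <= C + delta /\
  gromov d (h * x)%g 1%g (h * x * k)%g <= C + delta.
Proof.
rewrite -(gromov_left dH h) mulg1 mulgV => hx.
rewrite -(gromov_left dH (h * x)%g) mulg1 mulgK => xk xlong.
have hhx : d h (h * x)%g = len x by exact: hm_mulr dH _ _.
have := gromov_hyperbolic dH 1%g (h * x * k)%g (h * x)%g h.
have := gromov_hyperbolic dH h 1%g (h * x * k)%g (h * x)%g.
move: hx xk; rewrite /gromov (dC (h * x * k)%g (h * x)%g) (dC (h * x)%g h) hhx.
rewrite (dC h 1%g) (dC (h * x)%g 1%g).
by move=> h1 h2 [] h3 [] h4; split; lra.
Qed.

(** The points [h] and [h x] are determined, up to boundedly many choices, by
    their distances to [g = h x k]; acylindricity along the segment from [h] to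
    [h x] then bounds the number of elements [h] when [x] is long. *)
Lemma insertion_count : acylindrical_metric d -> forall C, exists rho, forall x,
    rho <= len x -> exists F : nat, forall g (l : nat),
  at_most (F * l.+1)%N [set k |
    [/\ gromov d 1%g (g * k^-1 * x^-1)^-1%g x <= C,
        gromov d 1%g x^-1%g k <= C & len k <= l%:R]].
Proof.
move=> d_acyl C.
have C0 := normr_ge0 C; have CC := ler_norm C; have d0 := delta_ge0.
(* the displacement allowed by [near_geodesic_close] once the distances of [h x]
   and [h] to [g] are known up to 1 and 2 respectively *)
have [rho [N acyl]] := d_acyl (`|C| + 2 * delta + 2) ltac:(lra).
exists (Num.max rho (`|C| + delta + 1)) => x; rewrite ge_max => /andP[xrho xC].
have [B xB] := real_lt_nat (len x).
exists (N * (2 * B).+1)%N => g l.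
pose h k := (g * k^-1 * x^-1)%g; pose u k := (g * k^-1)%g.
have hxu k : (h k * x)%g = u k by rewrite /h mulgVK.
have uk k : (u k * k)%g = g by rewrite /u mulgVK.
have dug k : d (u k) g = len k by rewrite -{1}(uk k) (hm_mulr dH).
have dhg k : d (h k) g = len (x * k)%g.
  by rewrite -{1}(uk k) -(hxu k) -mulgA (hm_mulr dH).
(* the second bin records the distance from [h] to [g] relative to that from
   [h x] to [g], shifted to be nonnegative; it takes boundedly many values *)
pose bin1 k (q : nat) := q%:R <= len k < q.+1%:R.
pose bin2 k (q : nat) := q%:R <= len (x * k)%g - len k + len x < q.+1%:R.
pose A := [set k | gromov d (h k) 1%g g <= C + delta /\
                   gromov d (u k) 1%g g <= C + delta].
apply: (@at_most_leq _ _ (l.+1 * ((2 * B).+1 * N))); first by apply: eq_leq; lia.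
have bin (r : R) : 0 <= r -> exists q : nat, q%:R <= r < q.+1%:R.
  by move=> r0; exists (Num.trunc r); exact: truncn_itv.
apply: (at_most_cover_nat (B := fun q => [set k | A k /\ bin1 k q])).
  move=> k /= [k1 k2 kl]; have [q kq] := bin _ (d_ge0 1%g k).
  exists q; first by rewrite -(ltr_nat R) -natr1; case/andP: kq; lra.
  split=> //; have := aligned_insertion k1 k2 ltac:(lra).
  by rewrite hxu uk.
move=> q1 _.
apply: (at_most_cover_nat
  (B := fun q => [set k | [/\ A k, bin1 k q1 & bin2 k q]])).
  move=> k /= [kA kq1].
  have kx : 0 <= len (x * k)%g - len k + len x.
    have := hm_lenM dH x^-1%g (x * k)%g.
    by rewrite mulKg (hm_lenV dH); lra.
  have [q kq2] := bin _ kx.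
  exists q => //; rewrite -(ltr_nat R) -natr1 natrM.
  by have := hm_lenM dH x k; case/andP: kq2; lra.
move=> q2 _; apply: at_most_local => k /= [[kh ku] /andP[k1 k1'] /andP[k2 k2']].
apply: (at_most_inj (f := fun k' => ((h k)^-1 * h k')%g) _ _ (acyl x xrho)).
  by move=> k' k'' _ _ /mulgI/mulIg/mulgI/invg_inj.
move=> k' /= [[kh' ku'] /andP[k3 k3'] /andP[k4 k4']].
move: k1' k2' k3' k4'; rewrite -!natr1 => k1' k2' k3' k4'.
split.
  rewrite -(hm_len dH).
  by have := near_geodesic_close kh kh' (eta := 2); rewrite !dhg; lra.
rewrite -(dL (h k)) mulgA mulVKg !hxu.
by have := near_geodesic_close ku ku' (eta := 1); rewrite !dug; lra.
Qed.

(** In a factor where the flanks [x] and [x'] have been chosen suitably, the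
    path [1], [x], [x y], [x y x'] leaves [1] along [x] and, whatever the length of
    [y], arrives at its end along [x']. *)
Lemma flank_direction x y x' z w C :
    gromov d 1%g x z <= C -> gromov d 1%g x^-1%g (y * x')%g <= C ->
    gromov d 1%g x' y^-1%g <= C -> gromov d 1%g x'^-1%g w <= C ->
    2 * C + delta < 2 * len x -> 3 * C + delta < 2 * len x' ->
  [/\ len x - C <= len (x * y * x')%g,
      gromov d 1%g (x * y * x')%g z <= C + delta &
      gromov d 1%g (x * y * x')^-1%g w <= C + delta].
Proof.
set p := (x * y * x')%g => xz xy yx' x'w xlong x'long.
have yx'E : d x' y^-1%g = len (y * x')%g.
  by rewrite dC (hm_len dH) invgK.
have pE : d x^-1%g (y * x')%g = len p by rewrite (hm_len dH) invgK mulgA.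
have xpE : d x p = len (y * x')%g by rewrite /p -mulgA (hm_mulr dH).
have x'pE : d x'^-1%g p^-1%g = len (x * y)%g.
  by rewrite (hm_len dH) invgK /p invgM mulVKg (hm_lenV dH).
have xy_le := hm_lenM dH x y.
have yx_ge : len x - C <= len p.
  move: xy; rewrite /gromov pE (hm_lenV dH).
  by have := d_ge0 1%g (y * x')%g; lra.
split=> //.
  have := gromov_hyperbolic dH x p z 1%g.
  move: xy; rewrite /gromov pE xpE (hm_lenV dH) in xz *.
  by move=> h1 [] h2; lra.
have := gromov_hyperbolic dH x'^-1%g p^-1%g w 1%g.
move: xy yx'; rewrite /gromov pE x'pE yx'E !(hm_lenV dH) in x'w *.
by move=> h1 h2 [] h3; lra.
Qed.

(** In a factor where the flanks are bounded, [x y x'] and [y] differ boundedly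
    in length, and in direction after translating the tests. *)
Lemma short_flank x y x' z w K M :
    len x <= M -> len x' <= M ->
    gromov d 1%g y (x^-1 * z)%g <= K -> gromov d 1%g y^-1%g (x' * w)%g <= K ->
  [/\ len y - 2 * M <= len (x * y * x')%g,
      gromov d 1%g (x * y * x')%g z <= K + 4 * M &
      gromov d 1%g (x * y * x')^-1%g w <= K + 4 * M].
Proof.
have bound a b c v : gromov d 1%g (a * b * c)%g v <=
    gromov d 1%g b (a^-1 * v)%g + 2 * len a + 2 * len c.
  have h := gromov_moveR dH 1%g v (a * b * c)%g (a * b)%g.
  rewrite dC (hm_mulr dH) in h.
  have := gromov_move_base dH 1%g a v (a * b)%g.
  have -> : gromov d a v (a * b)%g = gromov d 1%g (a^-1 * v)%g b.
    by rewrite -[RHS](gromov_left dH a) mulg1 mulVKg.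
  by move: h; rewrite !(gromovC dH _ v) !(gromovC dH _ (a^-1 * v)%g); lra.
move=> xM x'M yz yw; split.
- have := hm_lenM dH x^-1%g (x * y * x' * x'^-1)%g.
  have := hm_lenM dH (x * y * x')%g x'^-1%g.
  by rewrite mulgK mulKg !(hm_lenV dH); lra.
- by have := bound x y x' z; lra.
- have := bound x'^-1%g y^-1%g x^-1%g w.
  by rewrite !invgM !invgK mulgA !(hm_lenV dH); lra.
Qed.

End Insertion.

(** * Treating all factors at once *)

Section Product.
Context {R : realType} {I : finType} {G : I -> groupType}.
Implicit Types (H : groupClosed (gprod G)) (x y z w g h k : gprod G).

Lemma gprodM x y i : (x * y)%g i = (x i * y i)%g.
Proof. by rewrite ffunE. Qed.

Lemma gprodV x i : (x^-1)%g i = ((x i)^-1)%g.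
Proof. by rewrite ffunE. Qed.

Lemma gprod1 i : (1 : gprod G)%g i = 1%g.
Proof. by rewrite ffunE. Qed.

Lemma lift_seq H i (Y : seq (G i)) :
    (forall u, u \in Y -> (gproj i @` [set` H]) u) ->
  exists2 Y' : seq (gprod G),
    (forall y, y \in Y' -> y \in H) & Y = map (gproj i) Y'.
Proof.
elim: Y => [|y Y IH] YH; first by exists [::].
have [y' y'H y'y] := YH _ (mem_head _ _).
have [|Y' Y'H ->] := IH; first by move=> u uY; apply: YH; rewrite inE uY orbT.
exists (y' :: Y'); last by rewrite /= y'y.
by move=> u; rewrite inE => /predU1P[->|/Y'H].
Qed.

Context {d : forall i, G i -> G i -> R} {delta : I -> R}.
Hypothesis dH : forall i, hyperbolic_metric (d (i := i)) (delta i).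
Arguments d : clear implicits.
Local Notation len i := (d i 1%g).

(** A new coordinate is added by using the products [x y x']: the old elements
    [x] and [x'] determine the directions in the old coordinates, while in the
    new one they have bounded length and [y] determines the directions. The
    required lengths [rho] are functions of the bounds [C] because the bound in
    the new coordinate depends on the old elements, hence on their lengths. *)
Lemma simultaneous_selection H (J : seq I) :
    (forall i, i \in J -> selective (d i) (gproj i @` [set` H])) ->
  forall rho : I -> R -> R, exists (C : I -> R) (S : seq (gprod G)),
    (forall x, x \in S -> x \in H) /\
    forall z w, exists2 x, x \in S & forall i, i \in J ->
      [/\ rho i (C i) <= len i (x i), gromov (d i) 1%g (x i) (z i) <= C i &
          gromov (d i) 1%g (x i)^-1%g (w i) <= C i].
Proof.
elim: J => [|i0 J IH] sel rho.
  exists (fun=> 0), [:: 1%g]; split=> [x|z w].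
    by rewrite inE => /eqP->; exact: gpred1.
  by exists 1%g; rewrite ?mem_head.
have selJ i : i \in J -> selective (d i) (gproj i @` [set` H]).
  by move=> iJ; apply: sel; rewrite inE iJ orbT.
have [i0J|i0J] := boolP (i0 \in J).
  have [C [S [SH SP]]] := IH selJ rho; exists C, S; split=> // z w.
  have [x xS xP] := SP z w; exists x => // i.
  by rewrite inE => /predU1P[->|]; exact: xP.
have [C [S [SH SP]]] := IH selJ
  (fun i c => `|rho i (c + delta i)| + 3 * `|c| + delta i + 1).
have [M MP] := nat_bound S (fun x => len i0 (x i0)).
have [K KP] := sel i0 (mem_head _ _) (size S + size S)%N.
pose C1 i := if i == i0 then K + 4 * M%:R else C i + delta i.
have [Y [YH YP]] := KP (rho i0 (K + 4 * M%:R) + 2 * M%:R).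
have [Y' Y'H YY'] := lift_seq YH.
exists C1, [seq (x * yx')%g | x <- S,
                              yx' <- [seq (y * x')%g | y <- Y', x' <- S]].
split=> [_ /allpairsP[[x yx'] /= [xS /allpairsP[[y x'] /= [yY' x'S ->]] ->]]|z w].
  by apply: gpredM; [exact: SH | apply: gpredM; [exact: Y'H | exact: SH]].
(* [y] is chosen first, tested against all the flanks at once, then [x'], tested
   against [y^-1] only, and finally [x], whose inverse is tested against
   [y x'] *)
have [|y0 [y0Y y0L y0Z y0W]] := YP [seq ((x i0)^-1 * z i0)%g | x <- S]
    [seq (x i0 * w i0)%g | x : gprod G <- S].
  by rewrite !size_map.
move: y0Y y0L y0Z y0W; rewrite YY' => /mapP[y yY' ->] yL yZ yW.
have [x' x'S x'P] := SP y^-1%g w.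
have [x xS xP] := SP z (y * x')%g.
exists (x * (y * x'))%g; first by rewrite !allpairs_f.
move=> i; rewrite inE mulgA !(gprodM, gprodV) /C1.
have [->|ii0] /= := eqVneq i i0.
  move=> _; have [h1 h2 h3] := short_flank (dH i0) (MP x xS) (MP x' x'S)
     (yZ _ (map_f _ xS)) (yW _ (map_f (fun x : gprod G => (x i0 * w i0)%g) x'S)).
  by split=> //; move: yL; rewrite /gproj; lra.
move=> iJ; have [x1 x2] := xP i iJ; rewrite gprodM => x3.
have [x'1] := x'P i iJ; rewrite gprodV => x'2 x'3.
have := ler_norm (rho i (C i + delta i)); have := ler_norm (C i) => hC hr.
have := normr_ge0 (rho i (C i + delta i)); have := normr_ge0 (C i) => hC0 hr0.
have hd := hm_delta_ge0 (dH i).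
have xl : 2 * C i + delta i < 2 * len i (x i) by lra.
have xl' : 3 * C i + delta i < 2 * len i (x' i) by lra.
have [h1 h2 h3] := flank_direction (dH i) x2 x3 x'2 x'3 xl xl'.
by split=> //; lra.
Qed.

Lemma len_word (X : {fset gprod G}) : exists L : nat,
  forall (s : seq (gprod G)) i, is_word X s ->
    len i ((\prod_(x <- s) x)%g i) <= (L * size s)%:R.
Proof.
have [L LP] := nat_bound [seq (i, x) | i <- enum I, x <- enum_fset X]
                         (fun p => len p.1 (p.2 p.1)).
exists L => s i; elim: s => [|x s IH] /=.
  by move=> _; rewrite big_nil gprod1 (hm_refl (dH i)).
move=> /andP[xX /IH sL]; rewrite big_cons gprodM mulnS natrD.
apply: le_trans (hm_lenM (dH i) _ _) (lerD _ sL).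
case/orP: xX => xX; last rewrite -(hm_lenV (dH i)) -gprodV.
  by apply: (LP (i, x)); rewrite allpairs_f ?mem_enum.
by apply: (LP (i, x^-1%g)); rewrite allpairs_f ?mem_enum.
Qed.

Lemma len_word_length (X : {fset gprod G}) : generates X -> exists L : nat,
  forall g n, (word_length X g <= n)%N -> forall i, len i (g i) <= (L * n)%:R.
Proof.
move=> genX; have [L LP] := len_word X; exists L => g n gn i.
have [s [sX sg {1}<-]] := word_length_spelled g genX.
by apply: le_trans (LP s i sX) _; rewrite ler_nat sg leq_mul2l gn orbT.
Qed.

Lemma finite_subset_rel_ball (X : {fset gprod G}) H (S : seq (gprod G)) :
    (forall x, x \in S -> x \in H) ->
  exists eps : nat, forall x, x \in S -> rel_ball X H eps x.
Proof.
move=> SH; exists (\max_(x <- S) word_length X x)%N => x xS.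
by split; [exact: SH | exact: leq_bigmax_seq].
Qed.

(** In each factor the element [k] of a pair with [h x k = g] has linearly many
    possible values, either because the projection of [H] grows linearly or by
    [insertion_count]; the values in all the factors determine [k] and hence
    [h]. *)
Lemma polynomial_ambiguity H :
    (forall i, acylindrical_metric (d i)) ->
    (forall i,
      (exists F : nat, forall l : nat, at_most (F * l.+1)%N
         [set u | (gproj i @` [set` H]) u /\ len i u <= l%:R]) \/
      selective (d i) (gproj i @` [set` H])) ->
  forall X : {fset gprod G}, generates X ->
  exists a b : nat, [/\ (0 < a)%N, (0 < b)%N &
    relative_ambiguity_function X H (fun n => b * (a * n.+1) ^ #|I|)%N].
Proof.
move=> dA dich X genX.
have rhoE i := choice (insertion_count (dH i) (dA i)).
pose rho i := projT1 (rhoE i); have rhoP i := projT2 (rhoE i).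
pose J := [seq i <- enum I | `[< selective (d i) (gproj i @` [set` H]) >]].
have JP i : i \in J <-> selective (d i) (gproj i @` [set` H]).
  by rewrite mem_filter mem_enum andbT; split=> /asboolP.
have [C [S [SH SP]]] := simultaneous_selection (fun i => (JP i).1) rho.
have [L LP] := len_word_length genX.
pose V g n (x : gprod G) i := [set u : G i |
  [/\ (gproj i @` [set` H]) u, len i u <= n%:R & i \in J ->
   [/\ rho i (C i) <= len i (x i),
       gromov (d i) 1%g (g i * u^-1 * (x i)^-1)^-1%g (x i) <= C i &
       gromov (d i) 1%g (x i)^-1%g u <= C i]]].
have /choice[F FP] : forall p : I * gprod G, exists F : nat, forall g (n : nat),
    at_most (F * n.+1)%N (V g n p.2 p.1).
  move=> [i x] /=; have [iJ|iJ] := boolP (i \in J); last first.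
    have [[F FP]|/JP] := dich i; last by rewrite (negbTE iJ).
    by exists F => g n; apply: at_most_sub (FP n) => // u [].
  have [xl|xl] := leP (rho i (C i)) (len i (x i)).
    have [F FP] := rhoP i (C i) (x i) xl; exists F => g n.
    by apply: at_most_sub (FP (g i) n) => // u [_ un /(_ iJ)[_ u1 u2]]; split.
  exists 0%N => g n [|u s] // _ /(_ u (mem_head _ _))[_ _ /(_ iJ)[]].
  by rewrite leNgt xl.
pose F1 := (\max_(p <- [seq (i, x) | i <- enum I, x <- S]) F p)%N.
have F1P i x : x \in S -> (F (i, x) <= F1)%N.
  by move=> xS; apply: leq_bigmax_seq; rewrite // allpairs_f ?mem_enum.
have /choice[e eP] : forall p : gprod G * gprod G, exists x, x \in S /\
    forall i, i \in J -> [/\ rho i (C i) <= len i (x i),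
      gromov (d i) 1%g (x i) (p.1^-1%g i) <= C i &
      gromov (d i) 1%g (x i)^-1%g (p.2 i) <= C i].
  by move=> [h k]; have [x xS xP] := SP h^-1%g k; exists x.
have [eps epsP] := finite_subset_rel_ball X SH.
exists (F1.+1 * L.+1)%N, (size S).+1; split=> //.
exists (fun h k => h * e (h, k) * k)%g.
  exists eps => h k hH kH; exists (e (h, k)) => //.
  by apply: epsP; case: (eP (h, k)).
move=> m n g gH; apply: at_most_card_le.
apply: (@at_most_leq _ _ (size S * (F1 * (L * n).+1) ^ #|I|)).
  rewrite leq_mul //; case: #|I| => [|r] //; rewrite leq_exp2r //.
  nia.
apply: (at_most_cover (B := fun x => [set p : gprod G * gprod G |
    [/\ p.2 \in H, (word_length X p.2 <= n)%N, e p = x & p.1 * x * p.2 = g]%g])).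
  by move=> [h k] /= [_ [kH kn] hk]; exists (e (h, k)) => //; case: (eP (h, k)).
move=> x xS; rewrite cardE.
apply: (@at_most_coordinates _ _ (fun i => G i : choiceType)
         (fun i (p : gprod G * gprod G) => p.2 i)).
  move=> [h k] [h' k'] /= [_ _ _ hk] [_ _ _ hk'] kk'.
  have k'k : k' = k by apply/ffunP => i; rewrite kk' ?mem_enum.
  by congr (_, _) => //; move: hk; rewrite -hk' k'k => /mulIg/mulIg.
move=> i _; apply: at_most_sub (FP (i, x) g (L * n)%N); last first.
  by rewrite leq_mul2r F1P ?orbT.
move=> _ [[h k] /= [kH kn hkx hk] <-]; split; [by exists k | exact: LP |].
have [_ xP] := eP (h, k); move=> /xP[]; rewrite hkx => x1 x2 x3; split=> //.
suff -> : (g i * (k i)^-1 * (x i)^-1)^-1%g = h^-1%g i.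
  by rewrite (gromovC (dH i)).
by rewrite -hk !gprodM !mulgK gprodV.
Qed.

End Product.

(** * Existence of the relative growth rate *)

Section Growth.
Context {G : groupType}.
Implicit Types (X : {fset G}) (H : groupClosed G).

Lemma word_lengthM X (g h : G) : generates X ->
  (word_length X (g * h)%g <= word_length X g + word_length X h)%N.
Proof.
move=> genX; apply: word_length_min.
have [u [uX us ug]] := word_length_spelled g genX.
have [v [vX vs vh]] := word_length_spelled h genX.
exists (u ++ v); split; first by rewrite /is_word all_cat; apply/andP.
  by rewrite size_cat us vs.
by rewrite big_cat /= ug vh.
Qed.

Lemma exponential_ball X : exists c : nat, forall n,
  at_most (c ^ n) [set g | exists2 m, (m <= n)%N & spelled X g m].
Proof.
pose js := 1%g :: enum_fset X ++ [seq x^-1%g | x <- enum_fset X].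
exists (size js); elim=> [|n IH].
  move=> [|x [|y s]] // /andP[xy _] sP; case/negP: xy.
  have [m + [w [_ wm <-]]] := sP x (mem_head _ _).
  have [m' + [v [_ vm <-]]] := sP y ltac:(by rewrite !inE eqxx orbT).
  rewrite !leqn0 => /eqP m0 /eqP m'0.
  by rewrite (size0nil (etrans wm m'0)) (size0nil (etrans vm m0)) mem_head.
rewrite expnS; apply: (at_most_cover (B := fun j => [set g |
    exists2 m, (m <= n)%N & spelled X (j^-1 * g)%g m])).
  move=> g /= [[|m] mn [[|x w] [/= wX // wm <-]]].
    exists 1%g; rewrite ?mem_head //; exists 0%N => //; exists [::].
    by rewrite big_nil invg1 mulg1.
  move: wX => /andP[xX wX]; exists x.
    rewrite inE mem_cat; case/orP: xX => [->|xX]; first by rewrite !orbT.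
    by rewrite -[x]invgK map_f ?orbT.
  by exists m => //; exists w; split=> //; [case: wm | rewrite big_cons mulKg].
move=> j _; apply: (at_most_inj (f := fun g => (j^-1 * g)%g) _ _ IH) => //.
by move=> x y _ _ /mulgI.
Qed.

Lemma rel_growth_exponential X H : generates X ->
  exists2 c : nat, (0 < c)%N & forall n, (rel_growth X H n <= c ^ n)%N.
Proof.
move=> genX; have [c cP] := exponential_ball X; exists c.+1 => // n.
apply: (leq_trans (n := (c ^ n)%N)); last by case: n => // n; rewrite leq_exp2r.
apply: cP; first exact: fset_uniq.
move=> g; rewrite in_fset_set ?inE; last exact: finite_rel_ball.
by move=> -[_ gn]; exists (word_length X g) => //; exact: word_length_spelled.
Qed.

Lemma rel_growth_mono X H m n : generates X -> (m <= n)%N ->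
  (rel_growth X H m <= rel_growth X H n)%N.
Proof.
move=> genX mn; apply: fsubset_leq_card.
rewrite -fset_set_sub; try exact: finite_rel_ball.
by move=> g [gH gm]; split=> //; exact: leq_trans mn.
Qed.

Lemma rel_growth_gt0 X H n : generates X -> (0 < rel_growth X H n)%N.
Proof.
move=> genX; rewrite cardfs_gt0; apply/fset0Pn; exists 1%g.
rewrite in_fset_set ?inE; last exact: finite_rel_ball.
split; first exact: gpred1.
apply: leq_trans (leq0n n); apply: word_length_min.
by exists [::]; rewrite big_nil.
Qed.

(** Concatenation maps pairs of ball elements to a slightly larger ball with
    fibres bounded by the ambiguity function. *)
Lemma rel_growth_concat X H f :
    generates X -> relative_ambiguity_function X H f ->
  exists eps : nat, forall m n,
    (rel_growth X H m * rel_growth X H n <= rel_growth X H (m + n + eps) * f n)%N.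
Proof.
move=> genX [Phi [eps Phi_eps] Phi_f]; exists eps => m n.
have ballP k g : g \in fset_set (rel_ball X H k) -> rel_ball X H k g.
  by rewrite in_fset_set ?inE //; exact: finite_rel_ball.
pose prod_ball := [set p : G * G | rel_ball X H m p.1 /\ rel_ball X H n p.2].
have : at_most (rel_growth X H (m + n + eps) * f n) prod_ball.
  apply: (at_most_cover (js := fset_set (rel_ball X H (m + n + eps)))
    (B := fun g => [set p : G * G | [/\ rel_ball X H m p.1, rel_ball X H n p.2
                                      & Phi p.1 p.2 = g]])).
    move=> [h k] /= [[hH hm] [kH kn]]; exists (Phi h k) => //.
    have [x [xH xe] ->] := Phi_eps h k hH kH.
    rewrite in_fset_set ?inE; last exact: finite_rel_ball.
    split; first by rewrite !gpredM.
    apply: leq_trans (word_lengthM _ _ genX) _; rewrite addnAC leq_add //.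
    by apply: leq_trans (word_lengthM _ _ genX) _; exact: leq_add.
  by move=> g /ballP[gH _]; apply: card_le_at_most; exact: Phi_f.
move=> /(_ [seq (h, k) | h <- fset_set (rel_ball X H m),
                         k <- fset_set (rel_ball X H n)]).
rewrite size_allpairs; apply.
  by apply: allpairs_uniq; rewrite ?fset_uniq // => -[? ?] [? ?] _ _ [-> ->].
by move=> _ /allpairsP[[h k] /= [/ballP hm /ballP kn ->]].
Qed.

End Growth.

Section Fekete.
Context {R : realType}.

(** The limit is the supremum of [(a n - phi n) / (n + eps)], which is a lower
    bound for the growth of [a] by iterated superadditivity and is asymptotic to
    [a n / n] because the defects [phi] and [eps] are negligible. *)
Lemma almost_superadditive_cvg (a phi : nat -> R) (eps : nat) (c : R) :
    (forall n, 0 <= a n <= n%:R * c) ->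
    (forall m n, (m <= n)%N -> a m <= a n) ->
    (forall m n, a m + a n <= a (m + n + eps)%N + phi n) ->
    (forall n, 0 <= phi n) ->
    (forall eta, 0 < eta -> exists N : nat, forall n, (N <= n)%N ->
       phi n <= eta * n%:R) ->
  exists l : R, (fun n => n%:R^-1 * a n) @ \oo --> l.
Proof.
move=> a_bd a_mono a_add phi0 phi_small.
have c0 : 0 <= c by have /andP[h1 h2] := a_bd 1%N; lra.
pose w n := (a n - phi n) / (n + eps)%:R.
pose W := [set w n.+1 | n in [set: nat]].
have Wub : has_ubound W.
  exists c => _ [n _ <-]; rewrite /w ler_pdivrMr ?ltr0n //.
  have /andP[_ h] := a_bd n.+1; have := phi0 n.+1.
  have : 0 <= c * eps%:R by rewrite mulr_ge0.
  by rewrite natrD; lra.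
have Wsup : has_sup W by split=> //; exists (w 1%N), 0%N.
set l := sup W; exists l; apply/cvgrPdist_le => e e0.
have e2 : 0 < e / 2 by lra.
have lower : exists N : nat, forall n, (N <= n)%N -> l - e <= n%:R^-1 * a n.
  have [_ [n0 _ <-] wn0] := sup_adherent e2 Wsup.
  set n1 := n0.+1 in wn0; pose p := (n1 + eps)%N.
  have p0 : (0 < p%:R :> R) by rewrite ltr0n.
  have mult k : k%:R * (p%:R * w n1) <= a (k * p)%N.
    elim: k => [|k IH]; first by rewrite mul0r; case/andP: (a_bd (0 * p)%N).
    have := a_add (k * p)%N n1; rewrite -addnA -/p addnC -mulSn.
    have pw : p%:R * w n1 = a n1 - phi n1 by rewrite /w mulrC divfK ?gt_eqF.
    by move: IH; rewrite -natr1 pw; lra.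
  have [N NP] := real_lt_nat (2 * p%:R * `|w n1| / e).
  exists N.+1 => n Nn.
  have n_gt0 : (0 < n%:R :> R) by rewrite ltr0n; case: n Nn.
  rewrite mulrC ler_pdivlMr //.
  (* [a n] is compared with its value at the largest multiple of [p] below [n] *)
  pose k := (n %/ p)%N.
  have kn : (k * p <= n)%N by exact: leq_trunc_div.
  have nk : (n < k * p + p)%N by rewrite -mulSnr ltn_ceil.
  have h1 := le_trans (mult k) (a_mono _ _ kn).
  have h2 : 2 * p%:R * `|w n1| <= e * n%:R.
    rewrite -ler_pdivrMl // mulrC; apply: le_trans (ltW NP) _.
    by rewrite ler_nat ltnW.
  have h3 : k%:R * p%:R <= n%:R :> R by rewrite -natrM ler_nat.
  have h4 : n%:R <= k%:R * p%:R + p%:R :> R by rewrite -natrM -natrD ler_nat ltnW.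
  have h5 : `|(n%:R - k%:R * p%:R) * w n1| <= p%:R * `|w n1|.
    rewrite normrM ler_wpM2r // ger0_norm; lra.
  have := ler_norm ((n%:R - k%:R * p%:R) * w n1).
  have h6 : (l - e / 2) * n%:R <= w n1 * n%:R by rewrite ler_wpM2r // ltW.
  by move: h1; lra.
have upper : exists N : nat, forall n, (N <= n)%N -> n%:R^-1 * a n <= l + e.
  have [N1 N1P] := phi_small (e / 2) e2.
  have [N2 N2P] := real_lt_nat (2 * eps%:R * `|l| / e).
  exists (maxn N1 N2).+1 => n; rewrite gtn_max => /andP[n1 n2].
  have n_gt0 : (0 < n)%N by apply: leq_trans n1.
  rewrite mulrC ler_pdivrMr ?ltr0n //.
  have wl : w n <= l.
    by apply: ub_le_sup => //; exists n.-1; rewrite ?prednK.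
  have h1 : a n <= l * (n + eps)%:R + phi n.
    by move: wl; rewrite /w ler_pdivrMr ?ltr0n ?addn_gt0 ?n_gt0 //; lra.
  have h2 := N1P n (ltnW n1).
  have h3 : 2 * eps%:R * `|l| <= e * n%:R.
    rewrite -ler_pdivrMl // mulrC; apply: le_trans (ltW N2P) _.
    by rewrite ler_nat ltnW.
  have h4 : l * eps%:R <= `|l| * eps%:R by rewrite ler_wpM2r // ler_norm.
  by move: h1; rewrite natrD; lra.
have [N1 N1P] := lower; have [N2 N2P] := upper.
exists (maxn N1 N2) => // n /=; rewrite geq_max => /andP[n1 n2].
by rewrite ler_distlC; have := N1P n n1; have := N2P n n2; lra.
Qed.

End Fekete.

(** A polynomial ambiguity function contributes a logarithmic defect to the
    logarithm of the growth function. *)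
Lemma ln_polynomial_small {R : realType} (a b r : nat) : (0 < a)%N -> (0 < b)%N ->
  forall eta : R, 0 < eta -> exists N : nat, forall n, (N <= n)%N ->
    ln (b * (a * n.+1) ^ r)%:R <= eta * n%:R.
Proof.
move=> a0 b0 eta eta0.
have a_gt0 : 0 < a%:R :> R by rewrite ltr0n.
have b_gt0 : 0 < b%:R :> R by rewrite ltr0n.
pose theta : R := eta / (2 * r.+1%:R).
have theta0 : 0 < theta by rewrite divr_gt0 // mulr_gt0.
pose K : R := ln b%:R + r%:R * (ln a%:R + theta - 1 - ln theta).
have [N NP] := real_lt_nat (2 * K / eta).
exists N => n Nn.
have lnn : ln n.+1%:R <= theta * n.+1%:R - 1 - ln theta.
  (* the tangent inequality for [ln], rescaled to have slope [theta] *)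
  have : ln (theta * n.+1%:R) <= theta * n.+1%:R - 1.
    rewrite -[in leLHS](subrK 1 (theta * _)) addrC; apply: le_ln1Dx.
    by have : 0 < theta * n.+1%:R; [rewrite mulr_gt0 | lra].
  by rewrite lnM ?posrE ?ltr0n //; lra.
rewrite natrM natrX natrM lnM ?posrE ?exprn_gt0 ?mulr_gt0 ?ltr0n //.
rewrite lnXn ?mulr_gt0 ?ltr0n // lnM ?posrE ?ltr0n // -[_ *+ r]mulr_natl.
have h1 : r%:R * (ln a%:R + ln n.+1%:R) <=
    r%:R * (ln a%:R + (theta * n.+1%:R - 1 - ln theta)).
  by rewrite ler_wpM2l // lerD2l.
have h2 : 2 * K <= eta * n%:R.
  rewrite -ler_pdivrMl // mulrC; apply: le_trans (ltW NP) _; by rewrite ler_nat.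
have h3 : r%:R * theta * n%:R <= eta / 2 * n%:R.
  rewrite ler_wpM2r //; have : theta * (2 * r.+1%:R) = eta by rewrite divfK.
  by rewrite -[r.+1%:R]natr1; lra.
by move: h1 h2; rewrite /K -[n.+1%:R]natr1; lra.
Qed.

Lemma rel_growth_root_cvg {R : realType} {G : groupType} (X : {fset G})
    (H : groupClosed G) (a b r : nat) :
    generates X -> (0 < a)%N -> (0 < b)%N ->
    relative_ambiguity_function X H (fun n => b * (a * n.+1) ^ r)%N ->
  cvg (rel_growth_root R X H @ \oo).
Proof.
move=> genX a0 b0 amb.
have [eps epsP] := rel_growth_concat genX amb.
have [c c0 cP] := rel_growth_exponential H genX.
have gr0 n := rel_growth_gt0 H n genX.
pose f n := (b * (a * n.+1) ^ r)%N.
have f0 n : (0 < f n)%N by rewrite muln_gt0 b0 expn_gt0 muln_gt0 a0.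
have [l ll] : exists l : R,
    (fun n => n%:R^-1 * ln (rel_growth X H n)%:R) @ \oo --> l.
  apply: (almost_superadditive_cvg (phi := fun n => ln (f n)%:R) (eps := eps)
            (c := ln c%:R)) => [n|m n mn|m n|n|].
  - rewrite ln_ge0 ?ler1n //= mulr_natl -lnXn ?ltr0n // -natrX.
    by rewrite ler_ln ?posrE ?ltr0n ?expn_gt0 ?gr0 ?c0 ?ler_nat.
  - by rewrite ler_ln ?posrE ?ltr0n ?gr0 ?ler_nat ?rel_growth_mono.
  - rewrite -!lnM ?posrE ?ltr0n // -!natrM.
    rewrite ler_ln ?posrE ?ltr0n; last by rewrite muln_gt0 gr0 f0.
      by rewrite ler_nat; exact: epsP.
    by rewrite muln_gt0 !gr0.
  - by rewrite ln_ge0 ?ler1n.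
  - exact: ln_polynomial_small.
have -> : rel_growth_root R X H =
    (fun n => expR (n%:R^-1 * ln (rel_growth X H n)%:R)).
  by apply/funext => n; rewrite /rel_growth_root /powR pnatr_eq0 gtn_eqF.
apply/cvg_ex; exists (expR l).
by apply: (cvg_comp _ _ ll); exact: continuous_expR.
Qed.

(** * Actions on hyperbolic spaces and the theorem *)

Section OrbitMetric.
Context {R : realType} {G : groupType} {Omega : metricType R}.
Variables (act : G -> Omega -> Omega) (x : Omega).
Hypothesis actP : acylindrical_hyperbolic_action act.

Definition orbit_metric (g h : G) : R := mdist (act g x) (act h x).

Lemma orbit_metric_hyperbolic :
  exists delta, hyperbolic_metric orbit_metric delta.
Proof.
have [[_ [delta hyp]] [act1 actM actI] _] := actP.
exists (2 * delta); split=> [g|g h|g h k|k g h|g h k l]; rewrite /orbit_metric.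
- exact: mdistxx.
- exact: metric_sym.
- exact: metric_triangle.
- by rewrite !actM actI.
- have := hyp (act l x) (act g x) (act h x) (act k x).
  rewrite /gromov_product lerBlDr ge_min => /orP[] h1; [left|right]; lra.
Qed.

Lemma orbit_metric_acylindrical : acylindrical_metric orbit_metric.
Proof.
have [_ [act1 actM actI] acyl] := actP.
move=> eps /acyl[rho [N [_ _ NP]]]; exists rho, N => c.
rewrite /orbit_metric act1 => cx.
apply: at_most_sub (card_le_at_most (NP _ _ cx)) => // u /= [].
by rewrite actM.
Qed.

End OrbitMetric.

Lemma loxodromic_axial_power {R : realType} {G : groupType} {Omega : metricType R}
    (act : G -> Omega -> Omega) (g : G) :
    acylindrical_hyperbolic_action act -> loxodromic act g ->
  exists x delta, hyperbolic_metric (orbit_metric act x) delta /\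
    exists n, axial (d := orbit_metric act x) (delta := delta) (g ^+ n)%g.
Proof.
move=> actP [x [lambda [c [l1 c0 qg]]]]; exists x.
have [delta dH] := orbit_metric_hyperbolic x actP; exists delta; split=> //.
apply: (axial_power dH (lambda := lambda) (c := c)); first by lra.
move=> n; have [_ [act1 _ _] _] := actP.
have /andP[+ _] := qg 0 (Posz n).
by rewrite /orbit_metric /= sub0r normrN mulrC.
Qed.

Theorem theorem6p6 (R : realType) (I : finType) (G : I -> groupType)
    (G_fg : forall i, finitely_generated (G i))
    (G_ah : forall i, acylindrically_hyperbolic R (G i))
    (H : groupClosed (gprod G))
    (H_lox : forall i : I, exists2 g : G i,
        (gproj i @` [set` H]) g & generalized_loxodromic R g) :
  (forall X : {fset gprod G}, generates X ->
     exists (f : nat -> nat) (p : {poly R}),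
       [/\ relative_ambiguity_function X H f,
           size p = #|I|.+1
         & forall n : nat, (f n)%:R <= p.[n%:R]])
  /\
  (forall X : {fset gprod G}, generates X ->
     cvg (rel_growth_root R X H @ \oo)).
Proof.
have factor i : exists dd : (G i -> G i -> R) * R,
    [/\ hyperbolic_metric dd.1 dd.2, acylindrical_metric dd.1 &
     (exists F : nat, forall l : nat, at_most (F * l.+1)%N
        [set u | (gproj i @` [set` H]) u /\ dd.1 1%g u <= l%:R]) \/
      selective dd.1 (gproj i @` [set` H])].
  have [g [h hH hg] [space [act [actP lox]]]] := H_lox i.
  have [x [delta [dH [n gax]]]] := loxodromic_axial_power actP lox.
  have dA := orbit_metric_acylindrical x actP.
  exists (orbit_metric act x, delta); split=> //.
  apply: (linear_or_selective dH _ _ _ _ gax dA).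
  - move=> _ _ [u uH <-] [v vH <-]; exists (u * v)%g; first exact: gpredM.
    by rewrite /gproj gprodM.
  - move=> _ [u uH <-]; exists u^-1%g; first by rewrite /= gpredV.
    by rewrite /gproj gprodV.
  - by exists 1%g; [exact: gpred1 | rewrite /gproj gprod1].
  - exists (h ^+ n)%g; first exact: gpredXn.
    rewrite -hg; elim: n {gax} => [|n IH].
      by rewrite !expg0 /gproj gprod1.
    by rewrite !expgS /gproj gprodM -IH.
pose d i := (projT1 (cid (factor i))).1.
pose delta i := (projT1 (cid (factor i))).2.
have dH i : hyperbolic_metric (d i) (delta i).
  by rewrite /d /delta; case: cid => dd [].
have dA i : acylindrical_metric (d i) by rewrite /d; case: cid => dd [].
have dich i : (exists F : nat, forall l : nat, at_most (F * l.+1)%N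
      [set u | (gproj i @` [set` H]) u /\ d i 1%g u <= l%:R]) \/
    selective (d i) (gproj i @` [set` H]) by rewrite /d; case: cid => dd [].
split=> X genX; have [a [b [a0 b0 amb]]] := polynomial_ambiguity dH dA dich genX.
  exists (fun n => b * (a * n.+1) ^ #|I|)%N, (b%:R *: (a%:R *: ('X + 1)) ^+ #|I|).
  split=> [||n]; first exact: amb.
    have sq : size (a%:R *: ('X + 1) : {poly R}) = 2%N.
      by rewrite size_scale ?pnatr_eq0 ?gtn_eqF // size_XaddC.
    rewrite size_scale ?pnatr_eq0 ?gtn_eqF //.
    rewrite -[LHS]prednK ?size_exp ?sq ?mul1n //.
    by rewrite size_poly_gt0 expf_neq0 // -size_poly_gt0 sq.
  by rewrite !hornerE natrM natrX natrM -[n.+1%:R]natr1.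
exact: (rel_growth_root_cvg genX a0 b0 amb).
Qed.
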